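(* Let $X$ be an arbitrary set and let $(A,\Omega,+,0,1)\in\mathcal{S}_{\mathcal{V}_1}^{0}$. Each mapping $h\colon X\to A$ can be extended to a unique homomorphism $\overline{\overline{h}}\colon(\mathcal{P}^{<\omega}F_{\mathcal{V}_1}(X),\Omega,\cup,\emptyset,\{1\})\to(A,\Omega,+,0,1)$ such that $\overline{\overline{h}}|_X=h$, where each $x\in X$ is identified with the singleton $\{x\}$.
   Context: Fix a finitary type $\Omega$ in which all operations have positive arity ($\Omega$ may be infinite), and adjoin a constant symbol $1$. An element $1$ of an algebra $(A,\Omega)$ is a unit if for every $n$-ary $\omega\in\Omega$ and every $x\in A$, $\omega(x,1,\ldots,1)=\omega(1,x,1,\ldots,1)=\cdots=\omega(1,\ldots,1,x)=x$. Let $\mathcal{V}_1$ be a variety of algebras $(A,\Omega,1)$ in which the distinguished constant $1$ is a unit. $(F_{\mathcal{V}_1}(X),\Omega,1)$ is the free algebra over $X$ in $\mathcal{V}_1$. A $0$-semilattice ordered $\mathcal{V}_1$-algebra with a unit is an algebra $(A,\Omega,+,0,1)$ with $(A,\Omega,1)\in\mathcal{V}_1$, $(A,+)$ a (join) semilattice with least element $0$ (with order $x\le y\Leftrightarrow x+y=y$), each $\omega\in\Omega$ distributing over $+$ in each argument ($\omega(x_1,\ldots,x_i+y_i,\ldots,x_n)=\omega(x_1,\ldots,x_i,\ldots,x_n)+\omega(x_1,\ldots,y_i,\ldots,x_n)$), and $\omega(x_1,\ldots,x_n)=0$ for each $\omega\in\Omega$ whenever some $x_i=0$. It is not assumed that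 $1$ is the greatest element of $(A,+)$. $\mathcal{S}^0_{\mathcal{V}_1}$ is the variety of all such algebras. $\mathcal{P}^{<\omega}B$ is the set of all finite subsets of $B$ (including $\emptyset$), with complex operations $\omega(B_1,\ldots,B_n)=\{\omega(b_1,\ldots,b_n)\mid b_i\in B_i\}$ (which is $\emptyset$ if some $B_i=\emptyset$) and set union $\cup$. *)

(* Defs.v *)
From mathcomp Require Import all_boot.
From mathcomp Require Import boolp classical_sets functions cardinality.

Set Implicit Arguments.
Unset Strict Implicit.
Unset Printing Implicit Defensive.

Local Open Scope classical_set_scope.

(* Infinitely many operation symbols are allowed; the constant 1 is adjoined
   separately, in [algebra1]. *)
Record signature := Signature {
  opsym : Type;
  arity : opsym -> nat;
  arity_gt0 : forall w, 0 < arity w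
}.

(* Algebras (A, Omega, 1). *)
Record algebra1 (S : signature) := Algebra1 {
  carrier :> Type;
  op : forall w : opsym S, ('I_(arity w) -> carrier) -> carrier;
  one : carrier
}.
Arguments op {S} a w _ : rename.
Arguments one {S} a : rename.

Definition is_hom1 (S : signature) (A B : algebra1 S) (f : A -> B) : Prop :=
  (forall (w : opsym S) (a : 'I_(arity w) -> A), f (op A w a) = op B w (f \o a))
  /\ f (one A) = one B.

Definition is_unit (S : signature) (A : algebra1 S) (e : A) : Prop :=
  forall (w : opsym S) (i : 'I_(arity w)) (x : A),
    op A w [eta fun=> e with i |-> x] = x.

Inductive term (S : signature) (Y : Type) : Type :=
| Var of Y
| One
| Op (w : opsym S) of ('I_(arity w) -> term S Y).
Arguments Var {S Y} _.
Arguments One {S Y}.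
Arguments Op {S Y} w _.

Fixpoint eval (S : signature) (Y : Type) (A : algebra1 S) (v : Y -> A)
    (t : term S Y) : A :=
  match t with
  | Var y => v y
  | One => one A
  | Op w ts => op A w (fun i => eval v (ts i))
  end.

(* Terms are finitary, so countably many variables suffice for identities. *)
Definition satisfies (S : signature) (A : algebra1 S)
    (e : term S nat * term S nat) : Prop :=
  forall v : nat -> A, eval v e.1 = eval v e.2.

Definition is_variety (S : signature) (V : algebra1 S -> Prop) : Prop :=
  exists E : set (term S nat * term S nat),
    forall A : algebra1 S, V A <-> (forall e, E e -> satisfies A e).

Definition is_unital_variety (S : signature) (V : algebra1 S -> Prop) : Prop :=
  is_variety V /\ (forall A : algebra1 S, V A -> is_unit (one A)).

Definition is_free (S : signature) (V : algebra1 S -> Prop) (X : Type)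
    (F : algebra1 S) (eta : X -> F) : Prop :=
  V F /\
  forall (B : algebra1 S) (g : X -> B), V B ->
    exists! gbar : F -> B, is_hom1 gbar /\ forall x, gbar (eta x) = g x.

(* Algebras (A, Omega, +, 0, 1), before any axiom is imposed. *)
Record algebra01 (S : signature) := Algebra01 {
  reduct :> algebra1 S;
  add : reduct -> reduct -> reduct;
  zero : reduct
}.
Arguments add {S} a _ _ : rename.
Arguments zero {S} a : rename.

Definition is_hom01 (S : signature) (A B : algebra01 S) (f : A -> B) : Prop :=
  [/\ is_hom1 f,
      forall x y : A, f (add A x y) = add B (f x) (f y)
    & f (zero A) = zero B].

Definition add_le (S : signature) (A : algebra01 S) (x y : A) : Prop :=
  add A x y = y.

(* The class S^0_V for a variety V whose constant 1 is a unit. *)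
Definition semilattice_ordered0 (S : signature) (V : algebra1 S -> Prop)
    (A : algebra01 S) : Prop :=
  [/\ V A,
      [/\ associative (add A), commutative (add A) & idempotent_op (add A)],
      forall x : A, add_le (zero A) x,
      forall (w : opsym S) (i : 'I_(arity w)) (a : 'I_(arity w) -> A) (x y : A),
        op A w [eta a with i |-> add A x y] =
        add A (op A w [eta a with i |-> x]) (op A w [eta a with i |-> y])
    & forall (w : opsym S) (a : 'I_(arity w) -> A),
        (exists i, a i = zero A) -> op A w a = zero A].

Definition fin_subset (T : Type) : Type := {B : set T | finite_set B}.

Definition complex_op (S : signature) (A : algebra1 S) (w : opsym S)
    (B : 'I_(arity w) -> set A) : set A :=
  [set op A w b | b in [set b : 'I_(arity w) -> A | forall i, B i (b i)]].

Lemma finite_set_choice (n : nat) (T : Type) (B : 'I_n -> set T) :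
  (forall i, finite_set (B i)) ->
  finite_set [set b : 'I_n -> T | forall i, B i (b i)].
Proof.
move=> finB.
have /choice[s sE] i : exists s : seq {classic T}, B i = [set` s].
  exact/(@finite_seqP {classic T}).
have [[b0 _]|noB] := pselect (exists b, forall i, B i (b i)); last first.
  apply: (sub_finite_set _ (finite_set0 _)) => b /= Bb.
  by apply: noB; exists b.
pose N := \max_(i < n) size (s i).
pose phi (f : {ffun 'I_n -> 'I_N}) i : T := nth (b0 i : {classic T}) (s i) (f i).
apply: (sub_finite_set _ (finite_image phi (@finite_finset _ setT))) => b /= Bb.
have sb i : (b i : {classic T}) \in s i by have := Bb i; rewrite sE.
have ltN i : index (b i : {classic T}) (s i) < N.
  by apply: (@leq_trans (size (s i))); [rewrite index_mem | exact: leq_bigmax].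
exists [ffun i => Ordinal (ltN i)] => //.
by apply/funext => i; rewrite /phi ffunE /= nth_index.
Qed.

Lemma finite_complex_op (S : signature) (A : algebra1 S) (w : opsym S)
    (B : 'I_(arity w) -> set A) :
  (forall i, finite_set (B i)) -> finite_set (complex_op B).
Proof. by move=> finB; apply: finite_image; exact: finite_set_choice. Qed.

Definition fin_complex_op (S : signature) (A : algebra1 S) (w : opsym S)
    (B : 'I_(arity w) -> fin_subset A) : fin_subset A :=
  exist _ (complex_op (fun i => sval (B i)))
    (finite_complex_op (fun i => svalP (B i))).

Lemma finite_union (T : Type) (B C : fin_subset T) :
  finite_set (sval B `|` sval C).
Proof. by rewrite finite_setU; split; exact: svalP. Qed.

Definition fin_union (T : Type) (B C : fin_subset T) : fin_subset T :=
  exist _ (sval B `|` sval C) (finite_union B C).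

Definition fin_empty (T : Type) : fin_subset T := exist _ set0 (finite_set0 T).

Definition fin_singleton (T : Type) (x : T) : fin_subset T :=
  exist _ [set x] (finite_set1 x).

Definition fin_powerset_algebra (S : signature) (A : algebra1 S) : algebra01 S :=
  @Algebra01 S
    (@Algebra1 S (fin_subset A) (@fin_complex_op S A) (fin_singleton (one A)))
    (@fin_union A) (fin_empty A).

(* Main.v *)
Require Import Defs.
From mathcomp Require Import all_boot.
From mathcomp Require Import boolp classical_sets functions cardinality.

(** The free algebra [F] carries a unique homomorphism [g : F -> A] extending
    [h], and the finite subsets of [F] form the free join-semilattice with
    least element over the set [F].  So the only candidate for the extension
    sends a finite set [B] to the join in [A] of the [g b], [b] in [B].

    This join is handled through its universal property ([is_finite_join]): it
    is below [u] exactly when every [g b] is.  Two elements with the same upper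
    bounds are equal ([add_le_yoneda]), so all homomorphism laws become
    equivalences between upper-bound conditions.  The only law that needs work
    is compatibility with an operation [w]: an upper bound of all the
    [w (g b_1, ..., g b_n)] must bound [w] of the joins.  One replaces the
    elements [g b_i] by the joins one coordinate at a time
    ([coordinatewise_replacement]); each replacement is legitimate because, in
    one argument, [w] preserves finite joins: it distributes over [+], and it
    annihilates [0], which takes care of empty sets ([op_join_le]).

    For uniqueness, [b |-> f {b}] is a homomorphism [F -> A] for any extension
    [f], because the complex operations act on singletons as the operations of
    [F]; freeness of [F] makes it [g], and finite sets are unions of
    singletons ([fin_subset_ind]). *)

Set Implicit Arguments.
Unset Strict Implicit.
Unset Printing Implicit Defensive.

Local Open Scope classical_set_scope.

(** * Finite subsets and families *)

Lemma fin_subset_eq (T : Type) (B C : fin_subset T) : sval B = sval C -> B = C.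
Proof.
case: B C => [B fB] [C fC] /= BC; subst C.
by rewrite (Prop_irrelevance fB fC).
Qed.

(** Finite sets are generated by singletons under empty and binary unions: this
    is what makes them the free semilattice with a least element. *)
Lemma fin_subset_ind (T : Type) (P : fin_subset T -> Prop) :
  P (fin_empty T) -> (forall x, P (fin_singleton x)) ->
  (forall B C, P B -> P C -> P (fin_union B C)) ->
  forall B, P B.
Proof.
move=> P0 P1 PU [B fB]; have /(@finite_seqP {classic T})[s Bs] := fB.
elim: s B fB Bs => [|x s IHs] B fB Bs.
  suff -> : exist _ B fB = fin_empty T by [].
  by apply: fin_subset_eq; rewrite /= Bs set_nil.
have fs : finite_set ([set` s] : set T).
  by apply/(@finite_seqP {classic T}); exists s.
suff -> : exist _ B fB = fin_union (fin_singleton x) (exist _ _ fs).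
  by apply: PU => //; exact: IHs.
apply: fin_subset_eq; rewrite /= Bs; apply/seteqP; split=> y /=.
  by rewrite in_cons => /orP[/eqP|]; [left | right].
by rewrite in_cons => -[->|->]; rewrite ?eqxx ?orbT.
Qed.

Lemma fin_complex_op_singleton (S : signature) (F : algebra1 S) (w : opsym S)
    (b : 'I_(arity w) -> F) :
  fin_complex_op (fun i => fin_singleton (b i)) = fin_singleton (op F w b).
Proof.
apply: fin_subset_eq; apply/seteqP; split=> y /=.
  by case=> c /= cb <-; congr op; apply/funext.
by move=> ->; exists b.
Qed.

(** Lets a property of families be transferred from families chosen in
    prescribed sets to one fixed family [t], provided a single coordinate can
    always be transferred.  It gives both monotonicity of the operations and
    their compatibility with finite joins. *)
Lemma coordinatewise_replacement (I : finType) (T : Type)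
    (P : (I -> T) -> Prop) (C : I -> set T) (t : I -> T) :
  (forall a i, (forall y, C i y -> P [eta a with i |-> y]) ->
     P [eta a with i |-> t i]) ->
  (forall a, (forall i, C i (a i)) -> P a) ->
  P t.
Proof.
move=> step base.
(* [s] lists the coordinates in which the replacement has been made. *)
suff replaced (s : seq I) a : (forall i, if i \in s then a i = t i else C i (a i)) -> P a.
  by apply: (replaced (enum I) t) => i; rewrite mem_enum.
elim: s a => [|i s IHs] a aP; first exact: base.
have [si|si] := boolP (i \in s).
  apply: IHs => j; have := aP j; rewrite in_cons.
  by case: eqP => //= ->; rewrite si.
have -> : a = [eta a with i |-> t i].
  apply/funext => j /=; case: eqP => // ->.
  by have := aP i; rewrite mem_head.
apply: step => y Cy; apply: IHs => j /=.
by have := aP j; rewrite in_cons; case: eqP => //= ->; rewrite (negPf si).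
Qed.

(** * Order in a semilattice ordered algebra *)

Lemma add_le_refl (S : signature) (V : algebra1 S -> Prop) (A : algebra01 S)
    (hA : semilattice_ordered0 V A) (x : A) : add_le x x.
Proof. by case: hA => _ [_ _ idA] _ _ _; exact: idA. Qed.

Lemma add_le_trans (S : signature) (V : algebra1 S -> Prop) (A : algebra01 S)
    (hA : semilattice_ordered0 V A) (x y z : A) :
  add_le x y -> add_le y z -> add_le x z.
Proof.
case: hA => _ [assoA _ _] _ _ _; rewrite /add_le => xy yz.
by rewrite -yz assoA xy.
Qed.

Lemma add_le_add (S : signature) (V : algebra1 S -> Prop) (A : algebra01 S)
    (hA : semilattice_ordered0 V A) (x y u : A) :
  add_le (add A x y) u <-> add_le x u /\ add_le y u.
Proof.
case: hA => _ [assoA commA idA] _ _ _; rewrite /add_le; split=> [xyu|[xu yu]].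
  split; rewrite -xyu; first by rewrite !assoA idA.
  by rewrite (commA x) !assoA idA.
by rewrite -assoA yu.
Qed.

Lemma add_le_yoneda (S : signature) (V : algebra1 S -> Prop) (A : algebra01 S)
    (hA : semilattice_ordered0 V A) (x y : A) :
  (forall u, add_le x u <-> add_le y u) -> x = y.
Proof.
move=> xy; have yx : add_le y x by apply/xy; exact: add_le_refl hA x.
have {}xy : add_le x y by apply/xy; exact: add_le_refl hA y.
case: hA => _ [_ commA _] _ _ _.
by rewrite -[LHS]yx commA.
Qed.

Lemma op_le (S : signature) (V : algebra1 S -> Prop) (A : algebra01 S)
    (hA : semilattice_ordered0 V A) (w : opsym S) (a b : 'I_(arity w) -> A) :
  (forall i, add_le (a i) (b i)) -> add_le (op A w a) (op A w b).
Proof.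
have [_ _ _ distr _] := hA => ab.
apply: (@coordinatewise_replacement _ _
  (fun c => add_le (op A w c) (op A w b)) (fun i => [set b i]) a).
  move=> c i /(_ (b i) erefl); rewrite -{1}(ab i) distr.
  by case/(add_le_add hA).
move=> c cb; have -> : c = b by exact/funext.
exact: add_le_refl hA _.
Qed.

(** * Finite joins *)

(** The join of [g] over a finite set is given by its upper bounds rather than
    by an iterated sum: no enumeration of the set has to be chosen, and it
    need not be shown that enumerations with repetitions give the same value. *)
Definition is_finite_join (S : signature) (A : algebra01 S) (T : Type)
    (g : T -> A) (f : fin_subset T -> A) : Prop :=
  forall B u, add_le (f B) u <-> forall b, sval B b -> add_le (g b) u.

Lemma finite_join_exists (S : signature) (V : algebra1 S -> Prop)
    (A : algebra01 S) (hA : semilattice_ordered0 V A) (T : Type) (g : T -> A) :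
  exists f : fin_subset T -> A, is_finite_join g f.
Proof.
suff /choice[f fP] (B : fin_subset T) : exists s : A, forall u,
    add_le s u <-> forall b, sval B b -> add_le (g b) u by exists f.
have [_ _ le0 _ _] := hA.
elim/fin_subset_ind: B => [|x|B C [s sP] [t tP]].
- by exists (Defs.zero A) => u; split=> [_ b []|_]; exact: le0.
- by exists (g x) => u; split=> [gu b -> //|]; apply.
- exists (add A s t) => u; split=> [/(add_le_add hA)[/sP Bu /tP Cu] b [|]|BCu].
  + exact: Bu.
  + exact: Cu.
  + by apply/(add_le_add hA); split; [apply/sP | apply/tP] => b bP; apply: BCu;
      [left | right].
Qed.

Section FiniteJoinLaws.
Context (S : signature) (V : algebra1 S -> Prop) (A : algebra01 S).
Context (hA : semilattice_ordered0 V A) (T : Type) (g : T -> A).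
Context (f : fin_subset T -> A) (fP : is_finite_join g f).

Lemma finite_join_empty : f (fin_empty T) = Defs.zero A.
Proof.
have [_ _ le0 _ _] := hA.
by apply: (add_le_yoneda hA) => u; split=> // _; apply/fP => b [].
Qed.

Lemma finite_join_singleton x : f (fin_singleton x) = g x.
Proof.
apply: (add_le_yoneda hA) => u; split=> [/fP|gu]; first by apply.
by apply/fP => b ->.
Qed.

Lemma finite_join_union B C : f (fin_union B C) = add A (f B) (f C).
Proof.
apply: (add_le_yoneda hA) => u; split=> [/fP BCu|].
  by apply/(add_le_add hA); split; apply/fP => b bP; apply: BCu;
    [left | right].
by case/(add_le_add hA) => /fP Bu /fP Cu; apply/fP => b [/Bu|/Cu].
Qed.

(** In one argument, an operation preserves finite joins, by induction on the
    finite set; the empty join is the annihilation law for [0]. *)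
Lemma op_join_le (w : opsym S) (a : 'I_(arity w) -> A) i B u :
  (forall b, sval B b -> add_le (op A w [eta a with i |-> g b]) u) ->
  add_le (op A w [eta a with i |-> f B]) u.
Proof.
have [_ _ le0 distr op0] := hA.
elim/fin_subset_ind: B => [_|x|B C IHB IHC BCu].
- rewrite finite_join_empty op0; first exact: le0.
  by exists i; rewrite /= eqxx.
- by rewrite finite_join_singleton; apply.
- rewrite finite_join_union distr; apply/(add_le_add hA).
  by split; [apply: IHB | apply: IHC] => b bP; apply: BCu; [left | right].
Qed.

End FiniteJoinLaws.

(** * Homomorphisms from the algebra of finite subsets *)

(** Taking finite joins of the values of a homomorphism is again a homomorphism:
    both sides of the operation law have as upper bounds exactly those of the
    elements [w (g b_1, ..., g b_n)]. *)
Lemma finite_join_hom01 (S : signature) (V : algebra1 S -> Prop)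
    (F : algebra1 S) (A : algebra01 S) (hA : semilattice_ordered0 V A)
    (g : F -> A) (f : fin_powerset_algebra F -> A) :
  is_hom1 g -> is_finite_join g f -> is_hom01 f.
Proof.
move=> [gop g1] fP; split; last exact: (finite_join_empty hA fP).
- split; last by rewrite (finite_join_singleton hA fP).
  move=> w B; apply: (add_le_yoneda hA) => u; split=> [/fP opu|opu].
    apply: (@coordinatewise_replacement _ _ (fun a => add_le (op A w a) u)
      (fun i => g @` sval (B i))).
      by move=> a i gBu; apply: (op_join_le hA fP) => b Bb; apply: gBu; exists b.
    move=> a aP.
    have /choice[b bP] i : exists b, sval (B i) b /\ g b = a i.
      by have [b] := aP i; exists b.
    have -> : a = g \o b by apply/funext => i; case: (bP i).
    by rewrite -gop; apply: opu; exists b => // i; case: (bP i).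
  apply/fP => _ [b bP <-]; rewrite gop; apply: (add_le_trans hA _ opu).
  apply: (op_le hA) => i /=.
  (* each member of a set lies below the join of that set *)
  by have /fP := add_le_refl hA (f (B i)); apply.
- exact: (finite_join_union hA fP).
Qed.

Lemma hom01_singleton_hom1 (S : signature) (F : algebra1 S) (A : algebra01 S)
    (f : fin_powerset_algebra F -> A) :
  is_hom01 f -> is_hom1 (fun b => f (fin_singleton b)).
Proof.
case=> -[fop f1] _ _; split=> [w b|]; last exact: f1.
by rewrite -fin_complex_op_singleton; exact: fop.
Qed.

Lemma hom01_ext_singleton (S : signature) (F : algebra1 S) (A : algebra01 S)
    (f1 f2 : fin_powerset_algebra F -> A) :
  is_hom01 f1 -> is_hom01 f2 ->
  (forall b, f1 (fin_singleton b) = f2 (fin_singleton b)) -> f1 = f2.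
Proof.
move=> [_ f1D f10] [_ f2D f20] f12; apply/funext.
elim/fin_subset_ind => [|b|B C IHB IHC].
- by rewrite [LHS]f10 [RHS]f20.
- exact: f12.
- by rewrite [LHS]f1D [RHS]f2D IHB IHC.
Qed.

Theorem corollary4p4 (S : signature) (V1 : algebra1 S -> Prop)
    (hV1 : is_unital_variety V1)
    (X : Type) (F : algebra1 S) (eta : X -> F) (hF : is_free V1 eta)
    (A : algebra01 S) (hA : semilattice_ordered0 V1 A) (h : X -> A) :
  exists! hbar : fin_powerset_algebra F -> A,
    is_hom01 hbar /\ forall x : X, hbar (fin_singleton (eta x)) = h x.
Proof.
have [VA _ _ _ _] := hA; have [_ /(_ A h VA)[g [[ghom gh] guniq]]] := hF.
have [f fP] := finite_join_exists hA g.
have fhom : is_hom01 (f : fin_powerset_algebra F -> A).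
  exact: finite_join_hom01 hA _ _ ghom fP.
exists f; split=> [|f' [f'hom f'h]].
  by split=> // x; rewrite (finite_join_singleton hA fP).
apply: hom01_ext_singleton => // b; rewrite (finite_join_singleton hA fP).
by rewrite (guniq _ (conj (hom01_singleton_hom1 f'hom) f'h)).
Qed.
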